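(* Let $G$ be an infinite group and let $A$ be a subset of $G$. If $A$ is large, then $A$ is $\Delta$-large.
   Context: For a subset $A$ of an infinite group $G$, $\Delta(A) = \{g \in G : |gA \cap A| = \infty\}$, where $gA = \{ga : a \in A\}$. For subsets $F, A$ of $G$, $FA = \{fa : f \in F, a \in A\}$. A subset $A$ of $G$ is large if there exists a finite subset $F$ of $G$ such that $FA = G$; it is $\Delta$-large if there exists a finite subset $F$ of $G$ such that $F\Delta(A) = G$. *)

(* Defs.v *)
From mathcomp Require Import all_boot.
From mathcomp Require Import boolp classical_sets functions cardinality.

Set Implicit Arguments.
Unset Strict Implicit.
Unset Printing Implicit Defensive.

Local Open Scope classical_set_scope.

(* [groupType] (from monoid.v) covers arbitrary, possibly infinite groups. *)

Definition translate (G : groupType) (g : G) (A : set G) : set G :=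
  [set (g * a)%g | a in A].

Definition set_prod (G : groupType) (F A : set G) : set G :=
  [set (f * a)%g | f in F & a in A].

(* The intersection below is only required to be infinite, of any infinite
   cardinality. *)
Definition Delta (G : groupType) (A : set G) : set G :=
  [set g | infinite_set (translate g A `&` A)].

Definition large (G : groupType) (A : set G) : Prop :=
  exists F : set G, finite_set F /\ set_prod F A = [set: G].

Definition Delta_large (G : groupType) (A : set G) : Prop :=
  exists F : set G, finite_set F /\ set_prod F (Delta A) = [set: G].

(* Main.v *)
Require Import Defs.
From mathcomp Require Import all_boot.
From mathcomp Require Import boolp classical_sets functions cardinality.

(** If [G = F A] with [F] finite, then the same [F] satisfies [F Delta(A) = G].
    Since finitely many translates of [A] cover the infinite group [G], the set
    [A] is infinite.  Given [x], the infinite set [x A] is covered by the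
    finitely many sets [f A] with [f] in [F], so by pigeonhole [x A] meets some
    [f A] in an infinite set.  Translating by [f^-1] shows that [f^-1 x] lies in
    [Delta A], that is, [x = f (f^-1 x)] lies in [F Delta(A)]. *)

Local Open Scope classical_set_scope.

Lemma large_infinite (G : groupType) (A : set G) :
  infinite_set [set: G] -> large A -> infinite_set A.
Proof.
move=> Ginf [F [Ffin FA]] Afin; apply: Ginf.
by rewrite -FA; apply: finite_image2.
Qed.

(** The covering of [x A] by the sets [f A], translated back by [x^-1] so that
    each piece is a translate of the intersection which [Delta A] tests at
    [f^-1 x]. *)
Lemma large_cover (G : groupType) (F A : set G) (x : G) :
  set_prod F A = [set: G] ->
  A `<=` \bigcup_(f in F)
    translate (x^-1 * f)%g (translate (f^-1 * x)%g A `&` A).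
Proof.
move=> FA a Aa; have : set_prod F A (x * a)%g by rewrite FA.
case=> f Ff [b Ab fb_xa]; exists f => //; exists b.
- by split=> //; exists a => //; rewrite -mulgA -fb_xa mulKg.
- by rewrite -mulgA fb_xa mulKg.
Qed.

Theorem corollary5 (G : groupType) (Ginf : infinite_set [set: G]) (A : set G) :
  large A -> Delta_large A.
Proof.
move=> Alarge; have Ainf := large_infinite _ _ Ginf Alarge.
have [F [Ffin FA]] := Alarge; exists F; split=> //.
apply/seteqP; split=> // x _; apply: contrapT => xNF; apply: Ainf.
apply: sub_finite_set (large_cover _ _ _ x FA) _.
apply: bigcup_finite => // f Ff; apply: finite_image; apply: contrapT => fx_inf.
by apply: xNF; exists f => //; exists (f^-1 * x)%g => //; rewrite mulVKg.
Qed.
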